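(* The relative efficiency of the block $\ell_1/\ell_\infty$ program compared to the Lasso is given by $$R(\theta_{1,\infty},\theta_{\mathrm{Las}})=\frac{4-3\alpha}{2}\,\frac{\log(p-(2-\alpha)s)}{\log(p-s)} .$$ Thus, for sublinear sparsity $s/p\to0$, the block scheme has greater statistical efficiency (that is, $R<1$ asymptotically) for all overlaps $\alpha\in(2/3,1]$, but lower statistical efficiency (that is, $R>1$ asymptotically) for overlaps $\alpha\in[0,2/3)$.
   Context: The setting is that of two linear regression problems ($r=2$) in dimension $p$ with $n$ samples each, standard Gaussian designs, and regression vectors whose supports each have size $s$ and overlap in exactly $\alpha s$ entries, $\alpha\in[0,1]$. The performance of block $\ell_1/\ell_\infty$ regularization is governed by the order parameter $$\theta_{1,\infty}(n,p,s,\alpha):=\frac{n}{(4-3\alpha)s\log(p-(2-\alpha)s)},$$ and the performance of the naive method applying the Lasso separately to each regression problem is governed by $$\theta_{\mathrm{Las}}(n,p,s):=\frac{n}{2s\log(p-s)},$$ each method transitioning from failure to success as its order parameter crosses $1$. The relative efficiency coefficient is defined as $R(\theta_{1,\infty},\theta_{\mathrm{Las}}):=\theta_{\mathrm{Las}}(n,p,s)/\theta_{1,\infty}(n,p,s,\alpha)$; by definition $R<1$ means that the block method is more efficient, and $R>1$ that the naive Lasso method is more efficient. ''Asymptotically'' means for fixed $\alpha$ and all sufficiently large problems along a sequence with $p\to\infty$, $s/p\to0$. *)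

(* Defs.v *)
From mathcomp Require Import all_boot all_order all_algebra.
From mathcomp Require Import all_classical all_reals all_analysis.
Set Implicit Arguments.
Unset Strict Implicit.
Unset Printing Implicit Defensive.
Import Order.TTheory GRing.Theory Num.Theory.
Import numFieldNormedType.Exports.
Local Open Scope ring_scope.

(* Order parameters for two regression problems in dimension [p], with [n]
   samples and supports of size [s] each, overlapping in [alpha * s] entries.
   Sizes are cast to [R] before subtracting, so nothing is truncated. *)

Definition theta_block (R : realType) (n p s : nat) (alpha : R) : R :=
  n%:R / ((4 - 3 * alpha) * s%:R * ln (p%:R - (2 - alpha) * s%:R)).

Definition theta_lasso (R : realType) (n p s : nat) : R :=
  n%:R / (2 * s%:R * ln (p%:R - s%:R)).

(* The order parameters measure samples in units of the success threshold, so
   a ratio below 1 means that the first method needs fewer samples. *)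
Definition rel_efficiency (R : realType) (theta1 theta2 : R) : R :=
  theta2 / theta1.

(* Main.v *)
Require Import Defs.
From mathcomp Require Import all_boot all_order all_algebra.
From mathcomp Require Import ring lra.
From mathcomp Require Import all_classical all_reals all_analysis.
Import Order.TTheory GRing.Theory Num.Theory.
Import numFieldNormedType.Exports.
Local Open Scope classical_set_scope.
Local Open Scope ring_scope.

(** The factors [n] and [s] cancel in the quotient of the two order parameters,
    which leaves (4 - 3 alpha) / 2 times the ratio of the two logarithms. With
    sublinear sparsity and alpha in [0, 1], the argument p - (2 - alpha) s stays
    between p / 2 and p - s, itself at most p, as soon as s <= p / 4
    ([log_args_bounds]), so the logarithms differ by at most log 2 and
    their ratio tends to 1. The comparison of R with 1 is therefore decided by
    the prefactor, which crosses 1 exactly at alpha = 2 / 3.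

    Above 2/3 the logarithmic ratio is at most 1, so the prefactor alone keeps R
    below 1 ([rel_efficiency_lt1]). Below 2/3 the ratio is still at most 1 and
    works against the claim; there the excess of the prefactor over 1 beats the
    bounded loss log 2 once log p is large ([rel_efficiency_gt1]). *)

Lemma rel_efficiencyE (R : realType) (n p s : nat) (alpha : R) :
  (0 < n)%N -> (0 < s)%N ->
  rel_efficiency (theta_block n p s alpha) (theta_lasso R n p s) =
  (4 - 3 * alpha) / 2 *
    (ln (p%:R - (2 - alpha) * s%:R) / ln (p%:R - s%:R)).
Proof.
move=> n0 s0; rewrite /rel_efficiency /theta_block /theta_lasso.
have nN0 : n%:R != 0 :> R by rewrite pnatr_eq0 -lt0n.
have sN0 : s%:R != 0 :> R by rewrite pnatr_eq0 -lt0n.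
(* Inversion is multiplicative and involutive also at 0, so the two identities
   used next hold whatever the values of the logarithms. *)
set B := ln (_ - _ * _); set L := ln _.
rewrite !invfM !invrK.
transitivity ((n%:R / n%:R) * (s%:R / s%:R) *
  ((4 - 3 * alpha) / 2 * (B / L))); first by ring.
by rewrite !divff // !mul1r.
Qed.

(** The constant 1 / 4 is what makes (2 - alpha) s <= 2 s at most p / 2. *)
Lemma log_args_bounds (R : realType) (p s alpha : R) :
  0 <= alpha <= 1 -> 0 <= s -> s <= p / 4 ->
  p / 2 <= p - (2 - alpha) * s <= p - s.
Proof.
by move=> /andP[a0 a1] s0 sp; apply/andP; split; nra.
Qed.

(** The bound 2 < p puts both arguments above p / 2 > 1, where the logarithms
    are positive and their ratio can be compared with 1. *)
Lemma rel_efficiency_lt1 (R : realType) (n p s : nat) (alpha : R) :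
  (0 < n)%N -> (0 < s)%N -> 2 / 3 < alpha <= 1 ->
  (2 < p)%N -> s%:R <= p%:R / 4 :> R ->
  rel_efficiency (theta_block n p s alpha) (theta_lasso R n p s) < 1.
Proof.
move=> n0 s0 /andP[a23 a1] p2 sp; rewrite rel_efficiencyE //.
have a01 : 0 <= alpha <= 1 by lra.
have /andP[lo hi] := log_args_bounds _ _ _ _ a01 (ler0n R s) sp.
have p2R : 2 < p%:R :> R by rewrite ltr_nat.
set b := _ - _ * _ in lo hi *; set l := _ - s%:R in hi *.
have ln_b0 : 0 < ln b by apply: ln_gt0; lra.
have ln_bl : ln b <= ln l by rewrite ler_ln // posrE; lra.
have : ln b / ln l <= 1 by rewrite ler_pdivrMr ?mul1r //; lra.
nra.
Qed.

(** The threshold on log p is the solution of c (log p - log 2) = log p for the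
    prefactor c = (4 - 3 alpha) / 2, cleared of denominators. *)
Lemma rel_efficiency_gt1 (R : realType) (n p s : nat) (alpha : R) :
  (0 < n)%N -> (0 < s)%N -> 0 <= alpha < 2 / 3 ->
  (2 < p)%N -> s%:R <= p%:R / 4 :> R ->
  (4 - 3 * alpha) * ln 2 < (2 - 3 * alpha) * ln p%:R ->
  1 < rel_efficiency (theta_block n p s alpha) (theta_lasso R n p s).
Proof.
move=> n0 s0 /andP[a0 a23] p2 sp lnp; rewrite rel_efficiencyE //.
have a01 : 0 <= alpha <= 1 by lra.
have /andP[lo hi] := log_args_bounds _ _ _ _ a01 (ler0n R s) sp.
have p2R : 2 < p%:R :> R by rewrite ltr_nat.
have sR : 0 <= s%:R :> R by [].
set b := _ - _ * _ in lo hi *; set l := _ - s%:R in hi *.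
have ln_l0 : 0 < ln l by apply: ln_gt0; lra.
have ln_lp : ln l <= ln p%:R by rewrite ler_ln ?posrE /l; lra.
have ln_bp : ln p%:R - ln 2 <= ln b.
  by rewrite -ln_div ?posrE; [rewrite ler_ln ?posrE; lra | lra | lra].
rewrite mulrA ltr_pdivlMr // mul1r.
nra.
Qed.

Lemma near_small_sparsity (R : realType) (p s : nat -> nat) :
  p k @[k --> \oo] --> \oo ->
  ((s k)%:R / (p k)%:R : R) @[k --> \oo] --> (0 : R) ->
  \forall k \near \oo, (2 < p k)%N /\ (s k)%:R <= (p k)%:R / 4 :> R.
Proof.
move=> py sp0.
have p2 : \forall k \near \oo, (2 < p k)%N by exact: (py _ (nbhs_infty_gt 2)).
have sp : \forall k \near \oo, (s k)%:R / (p k)%:R < 1 / 4 :> R.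
  by apply: (cvgr_lt _ sp0); lra.
near=> k.
have pk2 : (2 < p k)%N by near: k.
have spk : (s k)%:R / (p k)%:R < 1 / 4 :> R by near: k.
have pk0 : 0 < (p k)%:R :> R by rewrite ltr0n (ltn_trans _ pk2).
split=> //; move: spk; rewrite ltr_pdivrMr //; lra.
Unshelve. all: by end_near. Qed.

Lemma near_ln_gt (R : realType) (p : nat -> nat) (M : R) :
  p k @[k --> \oo] --> \oo -> \forall k \near \oo, M < ln (p k)%:R.
Proof.
move=> py.
have : \forall k \near \oo, expR M < (p k)%:R :> R.
  exact: (py _ (nbhs_infty_gtr (expR M))).
apply: filterS => k Mp.
by rewrite -ltr_expR lnK // posrE (lt_trans (expR_gt0 M)).
Qed.

Theorem corollary2 (R : realType) :
  (forall (n p s : nat) (alpha : R),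
      (0 < n)%N -> (0 < s)%N -> 0 <= alpha <= 1 ->
      rel_efficiency (theta_block n p s alpha) (theta_lasso R n p s) =
      (4 - 3 * alpha) / 2 *
        (ln (p%:R - (2 - alpha) * s%:R) / ln (p%:R - s%:R)))
  /\
  (forall (alpha : R) (n p s : nat -> nat),
      (forall k, (0 < n k)%N) -> (forall k, (0 < s k)%N) ->
      p k @[k --> \oo] --> \oo ->
      ((s k)%:R / (p k)%:R : R) @[k --> \oo] --> (0 : R) ->
      (2 / 3 < alpha <= 1 ->
         \forall k \near \oo,
           rel_efficiency (theta_block (n k) (p k) (s k) alpha)
                          (theta_lasso R (n k) (p k) (s k)) < 1)
      /\
      (0 <= alpha < 2 / 3 ->
         \forall k \near \oo,
           1 < rel_efficiency (theta_block (n k) (p k) (s k) alpha)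
                              (theta_lasso R (n k) (p k) (s k)))).
Proof.
split=> [n p s alpha n0 s0 _|alpha n p s n0 s0 py sp0].
  exact: rel_efficiencyE.
have small := near_small_sparsity _ _ _ py sp0.
split=> alphaP.
  by apply: filterS small => k [p2 sp]; exact: rel_efficiency_lt1.
have c0 : 0 < 2 - 3 * alpha by lra.
have large := near_ln_gt _ _ ((4 - 3 * alpha) * ln 2 / (2 - 3 * alpha)) py.
apply: filterS2 small large => k [p2 sp]; rewrite ltr_pdivrMr // => lnp.
by apply: rel_efficiency_gt1 => //; rewrite [ltRHS]mulrC.
Qed.
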